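(* Define integers $a_{\mathcal{G}}(n)$, $n\ge0$, by $a_{\mathcal{G}}(0)=1$, $a_{\mathcal{G}}(1)=-1$, $a_{\mathcal{G}}(2)=-1$ and, for $n\ge 3$, $$a_{\mathcal{G}}(n)=-\frac12\left(\sum_{k=0}^{n-2}a_{\mathcal{G}}(k)\binom{n-1}{k}2^{n-1-k}+\sum_{k=0}^{n-1}a_{\mathcal{G}}(k)\binom{n}{k}2^{n-k}\right).$$ Write $\operatorname{sech}(x)=\sum_{n\ge0}s_n\frac{x^n}{n!}$. Then $s_{2n+1}=0$ and $s_{2n}=a_{\mathcal{G}}(2n)$ for all $n\ge 0$. *)

(* Defs.v *)
From Stdlib Require Import Reals Lra Lia Arith.
From Coquelicot Require Import Coquelicot.
Open Scope R_scope.

Definition aG_step (a : nat -> R) (n : nat) : R :=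
  match n with
  | 0%nat => 1
  | 1%nat => -1
  | 2%nat => -1
  | _ =>
      - (1 / 2) *
      (sum_f_R0 (fun k => a k * Binomial.C (n - 1) k * 2 ^ (n - 1 - k)) (n - 2)
       + sum_f_R0 (fun k => a k * Binomial.C n k * 2 ^ (n - k)) (n - 1))
  end.

(* [aG_fuel m n] is the intended value as soon as [n < m]; the recursion that
   [aG] satisfies is [aG_eq] below. *)
Fixpoint aG_fuel (m : nat) : nat -> R :=
  match m with
  | 0%nat => fun _ => 0
  | S m' => aG_step (aG_fuel m')
  end.

Definition aG (n : nat) : R := aG_fuel (S n) n.

Lemma aG_step_ext (a b : nat -> R) (n : nat) :
  (forall k, (k < n)%nat -> a k = b k) -> aG_step a n = aG_step b n.
Proof.
  intros H. destruct n as [|[|[|n]]]; try reflexivity.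
  unfold aG_step. do 2 f_equal; apply sum_eq; intros k Hk;
    rewrite H by lia; reflexivity.
Qed.

Lemma aG_fuel_indep (m p n : nat) :
  (n < m)%nat -> (n < p)%nat -> aG_fuel m n = aG_fuel p n.
Proof.
  revert p n; induction m as [|m IH]; intros [|p] n Hm Hp; try lia.
  simpl. apply aG_step_ext. intros k Hk. apply IH; lia.
Qed.

Lemma aG_eq (n : nat) : aG n = aG_step aG n.
Proof.
  unfold aG at 1. simpl. apply aG_step_ext. intros k Hk.
  apply aG_fuel_indep; lia.
Qed.

Lemma aG_0 : aG 0 = 1. Proof. reflexivity. Qed.
Lemma aG_1 : aG 1 = -1. Proof. reflexivity. Qed.
Lemma aG_2 : aG 2 = -1. Proof. reflexivity. Qed.

Lemma aG_rec (n : nat) : (3 <= n)%nat ->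
  aG n = - (1 / 2) *
    (sum_f_R0 (fun k => aG k * Binomial.C (n - 1) k * 2 ^ (n - 1 - k)) (n - 2)
     + sum_f_R0 (fun k => aG k * Binomial.C n k * 2 ^ (n - k)) (n - 1)).
Proof.
  intros Hn. rewrite aG_eq. destruct n as [|[|[|n]]]; try lia. reflexivity.
Qed.

Definition sech (x : R) : R := / cosh x.

Definition sech_expansion (s : nat -> R) : Prop :=
  locally 0 (fun x : R =>
    is_pseries (fun n => s n / INR (fact n)) x (sech x)).

(* Main.v *)
Require Import Defs.
From Stdlib Require Import Reals Lra Lia Arith.
From Coquelicot Require Import Coquelicot.
Open Scope R_scope.

(** Let [E = sech] and let [s] be the sequence of its derivatives at [0].  Then
    [E + E' = exp (-x) / cosh^2 x], so that [(E + E') exp (2 x) = E - E'].  On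
    coefficients, the binomial convolution of [u n = s n + s (n + 1)] with the
    powers of [2] is [s n - s (n + 1)]; adding two consecutive such identities
    gives a recursion in [u] alone, which is the one defining [aG].  Thus
    [aG n = s n + s (n + 1)], and one of the two terms vanishes because [E] is
    even.  Integrality is read off [E cosh = 1]. *)

(** * Power series expansions at 0 *)

Definition expands (a : nat -> R) (f : R -> R) : Prop :=
  locally 0 (fun x : R => is_pseries a x (f x)).

Definition geometrically_bounded (a : nat -> R) : Prop :=
  exists M q : R, 0 < q /\ forall n, Rabs (a n) <= M * q ^ n.

Lemma expands_geometrically_bounded (a : nat -> R) (f : R -> R) :
  expands a f -> geometrically_bounded a.
Proof.
  intros [d expansion].
  assert (0 < d / 2) as r_pos by (destruct d; simpl; lra).
  set (r := d / 2) in *.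
  assert (ex_series (fun n => a n * r ^ n)) as convergent.
  { exists (f r). apply is_pseries_R, expansion.
    change (Rabs (r - 0) < d). rewrite Rminus_0_r, Rabs_pos_eq; unfold r in *; lra. }
  destruct (filterlim_bounded _ (ex_intro _ 0 (ex_series_lim_0 _ convergent)))
    as [M bound].
  exists M, (/ r). split; [now apply Rinv_0_lt_compat|]. intros n.
  assert (0 < r ^ n) as rn_pos by now apply pow_lt.
  apply Rmult_le_reg_r with (r ^ n); [exact rn_pos|].
  rewrite pow_inv, Rmult_assoc, Rinv_l, Rmult_1_r by lra.
  rewrite <- (Rabs_pos_eq (r ^ n)), <- Rabs_mult by lra. apply bound.
Qed.

Lemma geometrically_bounded_CV_radius_pos (a : nat -> R) :
  geometrically_bounded a -> Rbar_lt 0 (CV_radius a).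
Proof.
  intros (M & q & q_pos & bound).
  apply Rbar_lt_le_trans with (/ q); [now apply Rinv_0_lt_compat|].
  apply CV_radius_bounded. exists M. intros n.
  assert (0 < q ^ n) as qn_pos by now apply pow_lt.
  rewrite Rabs_mult, pow_inv, (Rabs_pos_eq (/ q ^ n))
    by now apply Rlt_le, Rinv_0_lt_compat.
  apply Rmult_le_reg_r with (q ^ n); [exact qn_pos|].
  rewrite Rmult_assoc, Rinv_l, Rmult_1_r by lra. apply bound.
Qed.

Lemma expands_CV_radius_pos (a : nat -> R) (f : R -> R) :
  expands a f -> Rbar_lt 0 (CV_radius a).
Proof.
  intros a_expands. apply geometrically_bounded_CV_radius_pos.
  now apply expands_geometrically_bounded with f.
Qed.

Lemma locally_lt_CV_radius (a : nat -> R) :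
  Rbar_lt 0 (CV_radius a) -> locally 0 (fun x : R => Rbar_lt (Rabs x) (CV_radius a)).
Proof.
  destruct (CV_radius a) as [r| |]; intros radius_pos; try easy.
  - exists (mkposreal r radius_pos). intros x near_0.
    change (Rabs (x - 0) < r) in near_0. now rewrite Rminus_0_r in near_0.
  - now apply filter_forall.
Qed.

Lemma expands_PSeries (a : nat -> R) :
  Rbar_lt 0 (CV_radius a) -> expands a (PSeries a).
Proof.
  intros radius_pos. unfold expands.
  generalize (locally_lt_CV_radius a radius_pos). apply filter_imp.
  intros x inside. now apply PSeries_correct, CV_radius_inside.
Qed.

Lemma expands_ext (a b : nat -> R) (f g : R -> R) :
  (forall n, a n = b n) -> (forall x, f x = g x) -> expands a f -> expands b g.
Proof.
  intros eq_ab eq_fg. unfold expands. apply filter_imp. intros x.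
  rewrite <- eq_fg. now apply is_pseries_ext.
Qed.

Lemma expands_coef_unique (a b : nat -> R) (f : R -> R) :
  expands a f -> expands b f -> forall n, a n = b n.
Proof.
  intros a_expands b_expands n. apply PSeries_ext_recip.
  - now apply expands_CV_radius_pos with f.
  - now apply expands_CV_radius_pos with f.
  - generalize (filter_and _ _ a_expands b_expands). apply filter_imp.
    intros x [a_at_x b_at_x].
    now rewrite (is_pseries_unique _ _ _ a_at_x), (is_pseries_unique _ _ _ b_at_x).
Qed.

Lemma expands_fun_unique (a : nat -> R) (f g : R -> R) :
  expands a f -> expands a g -> locally 0 (fun x : R => f x = g x).
Proof.
  intros f_expands g_expands.
  generalize (filter_and _ _ f_expands g_expands). apply filter_imp.
  intros x [f_at_x g_at_x].
  now rewrite <- (is_pseries_unique _ _ _ f_at_x), (is_pseries_unique _ _ _ g_at_x).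
Qed.

Lemma expands_plus (a b : nat -> R) (f g : R -> R) :
  expands a f -> expands b g -> expands (fun n => a n + b n) (fun x => f x + g x).
Proof.
  intros a_expands b_expands. unfold expands.
  generalize (filter_and _ _ a_expands b_expands). apply filter_imp.
  intros x [a_at_x b_at_x]. exact (is_pseries_plus _ _ _ _ _ a_at_x b_at_x).
Qed.

Lemma expands_scal (c : R) (a : nat -> R) (f : R -> R) :
  expands a f -> expands (fun n => c * a n) (fun x => c * f x).
Proof.
  unfold expands. apply filter_imp. intros x a_at_x.
  exact (is_pseries_scal c a x _ (Rmult_comm x c) a_at_x).
Qed.

Lemma expands_mult (a b : nat -> R) (f g : R -> R) :
  expands a f -> expands b g -> expands (PS_mult a b) (fun x => f x * g x).
Proof.
  intros a_expands b_expands. unfold expands.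
  generalize (filter_and _ _ (filter_and _ _ a_expands b_expands)
    (filter_and _ _ (locally_lt_CV_radius _ (expands_CV_radius_pos _ _ a_expands))
                    (locally_lt_CV_radius _ (expands_CV_radius_pos _ _ b_expands)))).
  apply filter_imp. intros x [[a_at_x b_at_x] [inside_a inside_b]].
  now apply is_pseries_mult.
Qed.

Lemma expands_Derive (a : nat -> R) (f : R -> R) :
  expands a f -> expands (PS_derive a) (Derive f).
Proof.
  intros a_expands. unfold expands.
  generalize (filter_and _ _ (locally_locally _ _ a_expands)
    (locally_lt_CV_radius _ (expands_CV_radius_pos _ _ a_expands))).
  apply filter_imp. intros x [expansion_near_x inside].
  rewrite <- (Derive_ext_loc (PSeries a) f x).
  - now apply is_pseries_derive.
  - revert expansion_near_x. apply filter_imp. intros y. apply is_pseries_unique.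
Qed.

Lemma expands_comp_scal (c : R) (a : nat -> R) (f : R -> R) :
  expands a f -> expands (fun n => c ^ n * a n) (fun x => f (c * x)).
Proof.
  intros a_expands.
  assert (filterlim (fun x : R => c * x) (locally 0) (locally 0)) as to_0.
  { replace (locally 0) with (locally (c * 0)) at 2 by now rewrite Rmult_0_r.
    exact (filterlim_scal_r c 0). }
  generalize (to_0 _ a_expands). unfold filtermap, expands. apply filter_imp.
  intros x a_at_cx.
  apply is_pseries_R. apply is_pseries_R in a_at_cx. revert a_at_cx.
  apply is_series_ext. intros n. simpl. rewrite Rpow_mult_distr. ring.
Qed.

Lemma expands_even_coef_odd (a : nat -> R) (f : R -> R) :
  expands a f -> (forall x, f (- x) = f x) -> forall n, a (2 * n + 1)%nat = 0.
Proof.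
  intros a_expands f_even n.
  assert (expands (fun n => (-1) ^ n * a n) f) as reflected.
  { apply expands_ext with (3 := expands_comp_scal (-1) a f a_expands); [reflexivity|].
    intros x. rewrite <- f_even. f_equal. ring. }
  assert (sign := expands_coef_unique _ _ _ a_expands reflected (2 * n + 1)%nat).
  cbv beta in sign. rewrite Nat.add_1_r, pow_1_odd in *. lra.
Qed.

Lemma expands_1 : expands (pow 0) (fun _ => 1).
Proof.
  unfold expands. apply filter_forall. intros x. apply is_pseries_R.
  assert (is_series (fun n => 0 ^ n) 1) as geometric.
  { replace 1 with (/ (1 - 0)) by field. apply is_series_geom. rewrite Rabs_R0. lra. }
  revert geometric. apply is_series_ext. intros [|n]; simpl; ring.
Qed.

(** * Reciprocals of power series *)

Lemma course_of_values_recursion {A : Type} (default : A) (F : nat -> (nat -> A) -> A) :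
  (forall n f g, (forall k, (k < n)%nat -> f k = g k) -> F n f = F n g) ->
  exists f : nat -> A, forall n, f n = F n f.
Proof.
  intros F_ext.
  pose (restrict n (rec : forall k, (k < n)%nat -> A) k :=
    match lt_dec k n with left k_lt_n => rec k k_lt_n | right _ => default end).
  exists (Fix lt_wf (fun _ => A) (fun n rec => F n (restrict n rec))).
  intros n. rewrite Fix_eq.
  - apply F_ext. intros k k_lt_n. unfold restrict. now destruct (lt_dec k n).
  - intros m rec rec' eq_rec. apply F_ext. intros k _. unfold restrict.
    now destruct (lt_dec k m).
Qed.

Lemma PS_mult_S (a b : nat -> R) (n : nat) :
  PS_mult a b (S n) = sum_f_R0 (fun k => a k * b (S n - k)%nat) n + a (S n) * b 0%nat.
Proof. unfold PS_mult. now rewrite tech5, Nat.sub_diag. Qed.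

Lemma PS_mult_inverse_exists (a : nat -> R) :
  a 0%nat <> 0 -> exists b : nat -> R, forall n, PS_mult b a n = 0 ^ n.
Proof.
  intros a0_neq_0.
  destruct (course_of_values_recursion 0 (fun n b =>
    match n with
    | O => / a 0%nat
    | S m => - sum_f_R0 (fun k => b k * a (S m - k)%nat) m / a 0%nat
    end)) as [b b_rec].
  { intros [|n] f g eq_fg; [reflexivity|].
    do 2 f_equal. apply sum_eq. intros k k_le_n. now rewrite eq_fg by lia. }
  exists b. intros [|n].
  - unfold PS_mult. simpl. rewrite b_rec. now field.
  - rewrite PS_mult_S, (b_rec (S n)). simpl (0 ^ S n). now field.
Qed.

Lemma convolution_geometric_bound (a b : nat -> R) (A B L q : R) (n : nat) :
  0 <= A -> 0 <= B -> 0 <= q ->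
  (forall k, Rabs (a k) <= L * A * q ^ k) ->
  (forall k, (k <= n)%nat -> Rabs (b k) <= B * ((1 + L) * q) ^ k) ->
  Rabs (sum_f_R0 (fun k => b k * a (S n - k)%nat) n) <= A * B * ((1 + L) * q) ^ S n.
Proof.
  intros A_ge_0 B_ge_0 q_ge_0 a_bound b_bound.
  apply Rle_trans with (1 := Rsum_abs _ _).
  apply Rle_trans with (sum_f_R0 (fun k => (1 + L) ^ k * (A * B * q ^ S n * L)) n).
  - apply sum_Rle. intros k k_le_n. rewrite Rabs_mult.
    replace ((1 + L) ^ k * (A * B * q ^ S n * L))
      with (B * ((1 + L) * q) ^ k * (L * A * q ^ (S n - k))).
    + apply Rmult_le_compat; auto using Rabs_pos.
    + replace (S n) with (k + (S n - k))%nat at 2 by lia.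
      rewrite Rpow_mult_distr, pow_add. ring.
  - assert (L * sum_f_R0 (pow (1 + L)) n = (1 + L) ^ S n - 1) as geometric.
    { rewrite Rmult_comm, <- (Nat.add_1_r n), <- GP_finite. f_equal. ring. }
    rewrite <- scal_sum, (Rmult_assoc (A * B * q ^ S n)), geometric, Rpow_mult_distr.
    assert (0 <= A * B * q ^ S n) by (repeat apply Rmult_le_pos; auto using pow_le).
    lra.
Qed.

(* With [|a n| <= M q^n] and [L = M / |a 0|], the recursion for [b] gives
   [|b n| <= ((1 + L) q)^n / |a 0|] by induction. *)
Lemma geometrically_bounded_inverse (a b : nat -> R) :
  a 0%nat <> 0 -> (forall n, PS_mult b a n = 0 ^ n) ->
  geometrically_bounded a -> geometrically_bounded b.
Proof.
  intros a0_neq_0 inverse (M & q & q_pos & a_bound).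
  set (A := Rabs (a 0%nat)).
  assert (0 < A) as A_pos by now apply Rabs_pos_lt.
  assert (0 < M) as M_pos by (generalize (a_bound 0%nat); fold A; simpl; lra).
  set (L := M / A).
  assert (L * A = M) as LA by (unfold L; field; lra). rewrite <- LA in a_bound.
  assert (0 < L) as L_pos by now apply Rdiv_lt_0_compat.
  exists (/ A), ((1 + L) * q). split; [apply Rmult_lt_0_compat; lra|].
  intros n. induction n as [n IH] using (well_founded_induction lt_wf).
  apply Rmult_le_reg_l with A; [exact A_pos|].
  rewrite <- Rmult_assoc. unfold A at 1. rewrite <- Rabs_mult, Rmult_comm.
  destruct n as [|n].
  - generalize (inverse 0%nat). unfold PS_mult. simpl. intros ->.
    rewrite Rabs_R1, Rinv_r by lra. lra.
  - assert (recursion := inverse (S n)).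
    rewrite PS_mult_S, pow_i in recursion by lia.
    replace (b (S n) * a 0%nat)
      with (- sum_f_R0 (fun k => b k * a (S n - k)%nat) n) by lra.
    rewrite Rabs_Ropp.
    apply convolution_geometric_bound; try (apply Rlt_le; auto using Rinv_0_lt_compat).
    + exact a_bound.
    + intros k k_le_n. apply IH. lia.
Qed.

Lemma expands_inv (a : nat -> R) (f : R -> R) :
  expands a f -> a 0%nat <> 0 -> exists b : nat -> R, expands b (fun x => / f x).
Proof.
  intros a_expands a0_neq_0.
  destruct (PS_mult_inverse_exists a a0_neq_0) as [b inverse]. exists b.
  assert (expands b (PSeries b)) as b_expands.
  { apply expands_PSeries, geometrically_bounded_CV_radius_pos.
    apply (geometrically_bounded_inverse a); [assumption..|].
    now apply expands_geometrically_bounded with f. }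
  assert (locally 0 (fun x : R => PSeries b x * f x = 1)) as product_eq_1.
  { apply (expands_fun_unique (pow 0) (fun x => PSeries b x * f x) (fun _ => 1)).
    - now apply expands_ext
        with (1 := inverse) (3 := expands_mult _ _ _ _ b_expands a_expands).
    - exact expands_1. }
  unfold expands. generalize (filter_and _ _ b_expands product_eq_1). apply filter_imp.
  intros x [b_at_x product_x]. rewrite Rmult_comm in product_x.
  rewrite <- (Rmult_inv_r_uniq (f x) (PSeries b x)); [exact b_at_x| |exact product_x].
  intros f_x_0. rewrite f_x_0 in product_x. lra.
Qed.

(** * Exponential generating functions and binomial convolution *)

Definition is_egf (u : nat -> R) (f : R -> R) : Prop :=
  expands (fun n => u n / INR (fact n)) f.

Definition binom_conv (u v : nat -> R) (n : nat) : R :=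
  sum_f_R0 (fun k => u k * Binomial.C n k * v (n - k)%nat) n.

Lemma binom_conv_0 (u v : nat -> R) : binom_conv u v 0 = u 0%nat * v 0%nat.
Proof. unfold binom_conv. simpl. rewrite C_n_0. ring. Qed.

Lemma binom_conv_S (u v : nat -> R) (n : nat) :
  binom_conv u v (S n) =
  sum_f_R0 (fun k => u k * Binomial.C (S n) k * v (S n - k)%nat) n + u (S n) * v 0%nat.
Proof. unfold binom_conv. now rewrite tech5, C_n_n, Nat.sub_diag, Rmult_1_r. Qed.

Lemma binom_conv_ext_l (u u' v : nat -> R) (n : nat) :
  (forall k, (k <= n)%nat -> u k = u' k) -> binom_conv u v n = binom_conv u' v n.
Proof. intros eq_u. apply sum_eq. intros k k_le_n. now rewrite eq_u. Qed.

Lemma binom_conv_recursion_unique (u v w : nat -> R) :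
  w 0%nat <> -1 -> u 0%nat = v 0%nat ->
  (forall n, binom_conv u w (S n) + binom_conv u w n = u n - u (S n)) ->
  (forall n, binom_conv v w (S n) + binom_conv v w n = v n - v (S n)) ->
  forall n, u n = v n.
Proof.
  intros w0_neq eq_0 u_rec v_rec n.
  induction n as [n IH] using (well_founded_induction lt_wf).
  destruct n as [|n]; [exact eq_0|].
  assert (forall k, (k <= n)%nat -> u k = v k) as agree by (intros; apply IH; lia).
  assert (u_rec_n := u_rec n). assert (v_rec_n := v_rec n).
  rewrite binom_conv_S in u_rec_n, v_rec_n.
  rewrite (binom_conv_ext_l _ _ _ _ agree), (agree n (le_n n)) in u_rec_n.
  rewrite (sum_eq _ (fun k => v k * Binomial.C (S n) k * w (S n - k)%nat)) in u_rec_n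
    by (intros k k_le_n; now rewrite agree).
  apply Rmult_eq_reg_r with (w 0%nat + 1); lra.
Qed.

Lemma expands_is_egf (a : nat -> R) (f : R -> R) :
  expands a f -> is_egf (fun n => a n * INR (fact n)) f.
Proof.
  apply expands_ext; [|reflexivity]. intros n. field. apply INR_fact_neq_0.
Qed.

Lemma is_egf_coef_unique (u v : nat -> R) (f : R -> R) :
  is_egf u f -> is_egf v f -> forall n, u n = v n.
Proof.
  intros u_egf v_egf n. apply Rmult_eq_reg_r with (/ INR (fact n)).
  - exact (expands_coef_unique _ _ _ u_egf v_egf n).
  - apply Rinv_neq_0_compat, INR_fact_neq_0.
Qed.

Lemma is_egf_plus (u v : nat -> R) (f g : R -> R) :
  is_egf u f -> is_egf v g -> is_egf (fun n => u n + v n) (fun x => f x + g x).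
Proof.
  intros u_egf v_egf.
  apply expands_ext with (3 := expands_plus _ _ _ _ u_egf v_egf); [|reflexivity].
  intros n. simpl. field. apply INR_fact_neq_0.
Qed.

Lemma is_egf_scal (c : R) (u : nat -> R) (f : R -> R) :
  is_egf u f -> is_egf (fun n => c * u n) (fun x => c * f x).
Proof.
  intros u_egf. apply expands_ext with (3 := expands_scal c _ _ u_egf); [|reflexivity].
  intros n. simpl. field. apply INR_fact_neq_0.
Qed.

Lemma is_egf_mult (u v : nat -> R) (f g : R -> R) :
  is_egf u f -> is_egf v g -> is_egf (binom_conv u v) (fun x => f x * g x).
Proof.
  intros u_egf v_egf.
  apply expands_ext with (3 := expands_mult _ _ _ _ u_egf v_egf); [|reflexivity].
  intros n. unfold PS_mult, binom_conv, Rdiv.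
  rewrite (Rmult_comm (sum_f_R0 _ n)), scal_sum.
  apply sum_eq. intros k k_le_n. unfold Binomial.C.
  field. repeat split; apply INR_fact_neq_0.
Qed.

Lemma is_egf_Derive (u : nat -> R) (f : R -> R) :
  is_egf u f -> is_egf (fun n => u (S n)) (Derive f).
Proof.
  intros u_egf. apply expands_ext with (3 := expands_Derive _ _ u_egf); [|reflexivity].
  intros n. unfold PS_derive. rewrite fact_simpl, mult_INR. field.
  split; [apply INR_fact_neq_0 | apply not_0_INR; lia].
Qed.

Lemma is_egf_exp (c : R) : is_egf (pow c) (fun x => exp (c * x)).
Proof.
  assert (expands (fun n => / INR (fact n)) exp) as exp_1
    by (unfold expands; apply filter_forall; exact is_exp_Reals).
  exact (expands_comp_scal c _ _ exp_1).
Qed.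

Lemma is_egf_1 : is_egf (pow 0) (fun _ => 1).
Proof.
  apply expands_ext with (3 := expands_1); [|reflexivity].
  intros [|n]; simpl; unfold Rdiv; [rewrite Rinv_1|]; ring.
Qed.

Lemma is_egf_even_coef_odd (u : nat -> R) (f : R -> R) :
  is_egf u f -> (forall x, f (- x) = f x) -> forall n, u (2 * n + 1)%nat = 0.
Proof.
  intros u_egf f_even n.
  destruct (Rmult_integral _ _ (expands_even_coef_odd _ _ u_egf f_even n))
    as [|inv_0]; [easy|].
  now destruct (Rinv_neq_0_compat _ (INR_fact_neq_0 (2 * n + 1))).
Qed.

(** * Integrality *)

Definition is_integer (x : R) : Prop := exists z : Z, x = IZR z.

Lemma is_integer_plus (x y : R) : is_integer x -> is_integer y -> is_integer (x + y).
Proof. intros [a ->] [b ->]. exists (a + b)%Z. now rewrite plus_IZR. Qed.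

Lemma is_integer_minus (x y : R) : is_integer x -> is_integer y -> is_integer (x - y).
Proof. intros [a ->] [b ->]. exists (a - b)%Z. now rewrite minus_IZR. Qed.

Lemma is_integer_mult (x y : R) : is_integer x -> is_integer y -> is_integer (x * y).
Proof. intros [a ->] [b ->]. exists (a * b)%Z. now rewrite mult_IZR. Qed.

Lemma is_integer_pow (x : R) (n : nat) : is_integer x -> is_integer (x ^ n).
Proof. intros [a ->]. exists (a ^ Z.of_nat n)%Z. apply pow_IZR. Qed.

Lemma is_integer_sum (f : nat -> R) (n : nat) :
  (forall k, (k <= n)%nat -> is_integer (f k)) -> is_integer (sum_f_R0 f n).
Proof.
  induction n as [|n IH]; intros f_integer; simpl.
  - now apply f_integer.
  - apply is_integer_plus; [apply IH; intros k k_le_n|]; apply f_integer; lia.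
Qed.

Lemma is_integer_C (n k : nat) : (k <= n)%nat -> is_integer (Binomial.C n k).
Proof.
  revert k. induction n as [|n IH]; intros k k_le_n.
  - replace k with 0%nat by lia. exists 1%Z. apply C_n_0.
  - destruct k as [|k]; [exists 1%Z; apply C_n_0|].
    destruct (Nat.eq_dec k n) as [->|k_neq_n]; [exists 1%Z; apply C_n_n|].
    rewrite <- pascal by lia. apply is_integer_plus; apply IH; lia.
Qed.

Lemma is_integer_binom_conv_cancel (u v : nat -> R) :
  v 0%nat = 1 -> (forall n, is_integer (v n)) ->
  (forall n, is_integer (binom_conv u v n)) -> forall n, is_integer (u n).
Proof.
  intros v0 v_integer conv_integer n.
  induction n as [n IH] using (well_founded_induction lt_wf).
  destruct n as [|n].
  - rewrite <- (Rmult_1_r (u 0%nat)), <- v0, <- binom_conv_0. apply conv_integer.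
  - assert (last_term := binom_conv_S u v n). rewrite v0, Rmult_1_r in last_term.
    replace (u (S n)) with (binom_conv u v (S n)
      - sum_f_R0 (fun k => u k * Binomial.C (S n) k * v (S n - k)%nat) n) by lra.
    apply is_integer_minus; [apply conv_integer|].
    apply is_integer_sum. intros k k_le_n.
    apply is_integer_mult; [apply is_integer_mult|apply v_integer].
    + apply IH. lia.
    + apply is_integer_C. lia.
Qed.

(** * Coefficients of sech and the recursion of aG *)

Lemma cosh_pos (x : R) : 0 < cosh x.
Proof. unfold cosh. generalize (exp_pos x) (exp_pos (- x)). lra. Qed.

Lemma sech_opp (x : R) : sech (- x) = sech x.
Proof. unfold sech, cosh. now rewrite Ropp_involutive, Rplus_comm. Qed.

Lemma Derive_sech (x : R) : Derive sech x = - sinh x / cosh x ^ 2.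
Proof.
  apply is_derive_unique, is_derive_inv.
  - apply is_derive_Reals, derivable_pt_lim_cosh.
  - apply Rgt_not_eq, cosh_pos.
Qed.

Lemma sech_Derive_exp (x : R) :
  (sech x + Derive sech x) * exp (2 * x) = sech x - Derive sech x.
Proof.
  rewrite Derive_sech. unfold sech, cosh, sinh.
  replace (2 * x) with (x + x) by ring. rewrite exp_plus, exp_Ropp.
  assert (e_pos := exp_pos x). field. split; nra.
Qed.

Definition cosh_coef (n : nat) : R := / 2 * (1 ^ n + (-1) ^ n).

Lemma is_egf_cosh : is_egf cosh_coef cosh.
Proof.
  apply expands_ext
    with (3 := is_egf_scal (/ 2) _ _
                 (is_egf_plus _ _ _ _ (is_egf_exp 1) (is_egf_exp (-1)))).
  - reflexivity.
  - intros x. unfold cosh. rewrite Rmult_1_l.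
    replace (-1 * x) with (- x) by ring. field.
Qed.

Lemma is_integer_cosh_coef (n : nat) : is_integer (cosh_coef n).
Proof.
  assert (cosh_coef n = 0 \/ cosh_coef n = 1) as [-> | ->].
  - unfold cosh_coef. rewrite pow1. induction n as [|n IH]; simpl; lra.
  - now exists 0%Z.
  - now exists 1%Z.
Qed.

Lemma sech_expansion_exists : exists s : nat -> R, sech_expansion s.
Proof.
  destruct (expands_inv _ _ is_egf_cosh) as [b b_expands].
  - unfold cosh_coef. simpl. lra.
  - eexists. exact (expands_is_egf _ _ b_expands).
Qed.

Lemma aG_binom_conv (n : nat) :
  binom_conv aG (pow 2) (S n) + binom_conv aG (pow 2) n = aG n - aG (S n).
Proof.
  destruct n as [|[|n]].
  - rewrite binom_conv_S, binom_conv_0, aG_1. simpl. rewrite C_n_0, aG_0. ring.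
  - rewrite !binom_conv_S, aG_1, aG_2. unfold Binomial.C. simpl.
    rewrite aG_0, aG_1. field.
  - assert (recursion := aG_rec (S (S (S n))) ltac:(lia)).
    replace (S (S (S n)) - 1)%nat with (S (S n)) in recursion by lia.
    replace (S (S (S n)) - 2)%nat with (S n) in recursion by lia.
    rewrite !binom_conv_S. simpl (2 ^ 0). lra.
Qed.

Section SechCoefficients.

Variable s : nat -> R.
Hypothesis s_sech : sech_expansion s.

Lemma sech_coef_odd (n : nat) : s (2 * n + 1)%nat = 0.
Proof. exact (is_egf_even_coef_odd s sech s_sech sech_opp n). Qed.

Lemma sech_coef_binom_conv_cosh (n : nat) : binom_conv s cosh_coef n = 0 ^ n.
Proof.
  apply (is_egf_coef_unique _ _ (fun x => sech x * cosh x)).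
  - exact (is_egf_mult _ _ _ _ s_sech is_egf_cosh).
  - apply expands_ext with (3 := is_egf_1); [reflexivity|].
    intros x. unfold sech. field. apply Rgt_not_eq, cosh_pos.
Qed.

Lemma sech_coef_0 : s 0%nat = 1.
Proof.
  generalize (sech_coef_binom_conv_cosh 0). rewrite binom_conv_0.
  unfold cosh_coef. simpl. lra.
Qed.

Lemma is_integer_sech_coef (n : nat) : is_integer (s n).
Proof.
  apply (is_integer_binom_conv_cancel s cosh_coef).
  - unfold cosh_coef. simpl. field.
  - exact is_integer_cosh_coef.
  - intros m. rewrite sech_coef_binom_conv_cosh. apply is_integer_pow. now exists 0%Z.
Qed.

Lemma sech_coef_binom_conv_pow2 (n : nat) :
  binom_conv (fun k => s k + s (S k)) (pow 2) n = s n - s (S n).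
Proof.
  assert (s'_egf := is_egf_Derive _ _ s_sech).
  apply (is_egf_coef_unique _ (fun k => s k - s (S k))
           (fun x => sech x - Derive sech x)).
  - apply expands_ext with (3 :=
      is_egf_mult _ _ _ _ (is_egf_plus _ _ _ _ s_sech s'_egf) (is_egf_exp 2)).
    + reflexivity.
    + exact sech_Derive_exp.
  - apply expands_ext with (3 :=
      is_egf_plus _ _ _ _ s_sech (is_egf_scal (-1) _ _ s'_egf));
      intros; unfold Rdiv; ring.
Qed.

Lemma aG_sech_coef (n : nat) : aG n = s n + s (S n).
Proof.
  apply (binom_conv_recursion_unique aG (fun k => s k + s (S k)) (pow 2)).
  - simpl. lra.
  - rewrite aG_0, sech_coef_0, (sech_coef_odd 0 : s 1%nat = 0). ring.
  - exact aG_binom_conv.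
  - intros m. rewrite !sech_coef_binom_conv_pow2. ring.
Qed.

End SechCoefficients.

Theorem mainTheorem7 :
  (forall n : nat, exists z : Z, aG n = IZR z) /\
  (exists s : nat -> R, sech_expansion s) /\
  (forall s : nat -> R, sech_expansion s ->
     forall n : nat, s (2 * n + 1)%nat = 0 /\ s (2 * n)%nat = aG (2 * n)).
Proof.
  split; [|split].
  - intros n. destruct sech_expansion_exists as [s s_sech].
    rewrite (aG_sech_coef s s_sech).
    apply is_integer_plus; now apply is_integer_sech_coef.
  - exact sech_expansion_exists.
  - intros s s_sech n. assert (odd_0 := sech_coef_odd s s_sech n).
    split; [exact odd_0|].
    rewrite Nat.add_1_r in odd_0. rewrite (aG_sech_coef s s_sech), odd_0. ring.
Qed.
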